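(* Let $p\in[1,\infty)$, let $X=(X,d,\mu)$ be a $p$-admissible metric measure space, let $E\subset X$ be closed, and let $\nu$ be a locally finite Borel regular measure on $X$ with $\operatorname{supp}\nu\subset E$. Let $\theta\in(0,p)$, and assume that the trace operator $\operatorname{Tr}:B^{\theta/p}_{p,1}(X)\to L_p(E,\nu)$ is well defined and bounded. Then $\nu$ is upper codimension-$\theta$ regular, that is, there exists a constant $C>0$ such that $$\nu(B_r(x)\cap E)\le C\,\frac{\mu(B_r(x))}{r^\theta}\qquad\text{for all }(x,r)\in E\times(0,1].$$
   Context: A metric measure space $(X,d,\mu)$ consists of a complete separable metric space $(X,d)$ and a Borel regular (outer) measure $\mu$ with $0<\mu(B_r(x))<\infty$ for all $x\in X$, $r>0$, where $B_r(x)$ is the open ball. A measure is locally finite if it is finite on all balls. For a Lipschitz function $f:X\to\mathbb R$, $\operatorname{lip}f(x)=\limsup_{y\to x}\frac{|f(y)-f(x)|}{d(y,x)}$ if $x$ is an accumulation point and $\operatorname{lip}f(x)=0$ if $x$ is isolated. For $q\in[1,\infty)$, the space is $q$-admissible if: (1) $\mu$ is uniformly locally doubling: for every $R>0$ there is $C_\mu(R)>0$ with $\mu(B_{2r}(x))\le C_\mu(R)\mu(B_r(x))$ for all $x\in X$, $r\in(0,R]$; (2) it supports a local weak $(1,q)$-Poincaré inequality: for every $R>0$ there are $C=C(R)>0$, $\lambda=\lambda(R)\ge1$ such that for every Lipschitz $f:X\to\mathbb R$, all $x\in X$ and $r\in(0,R]$, $$\frac1{\mu(B_r(x))}\int_{B_r(x)}\Big|f-\frac1{\mu(B_r(x))}\int_{B_r(x)}f\,d\mu\Big|\,d\mu\le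 Cr\Big(\frac1{\mu(B_{\lambda r}(x))}\int_{B_{\lambda r}(x)}(\operatorname{lip}f)^q\,d\mu\Big)^{1/q}.$$ For $f\in L_1^{\mathrm{loc}}(X)$ (integrable on balls) and $t>0$, put $$\overline\Delta_tf(x)=\frac1{\mu(B_t(x))}\int_{B_t(x)}\Big|f(y)-\frac1{\mu(B_t(x))}\int_{B_t(x)}f\,d\mu\Big|\,d\mu(y).$$ For $s\in(0,1)$, $B^s_{p,1}(X)$ consists of all $f\in L_p(X)=L_p(X,\mu)$ with $\|f\|_{b^s_{p,1}(X)}:=\int_0^1 t^{-s}\|\overline\Delta_tf\|_{L_p(X)}\frac{dt}{t}<\infty$, with norm $\|f\|_{B^s_{p,1}(X)}=\|f\|_{L_p(X)}+\|f\|_{b^s_{p,1}(X)}$. Given $f\in L_1^{\mathrm{loc}}(X)$, a $\nu$-measurable $\phi:E\to\mathbb R$ is a trace of $f$ to $E$ if $\lim_{r\to0}\frac1{\mu(B_r(x))}\int_{B_r(x)}|f(y)-\phi(x)|\,d\mu(y)=0$ for $\nu$-a.e. $x\in E$; its class modulo $\nu$-negligible sets is $\operatorname{Tr}f$. The trace operator is well defined on a function space if each of its elements has a trace to $E$. *)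

(* Defs.v *)
From HB Require Import structures.
From mathcomp Require Import all_boot all_order all_algebra.
From mathcomp Require Import all_classical all_reals all_analysis.

Set Implicit Arguments.
Unset Strict Implicit.
Unset Printing Implicit Defensive.

Import Order.TTheory GRing.Theory Num.Theory.
Import numFieldNormedType.Exports.

Local Open Scope classical_set_scope.
Local Open Scope ring_scope.

(* [ball x r] is the open ball [set y | mdist x y < r] (lemma [ballEmdist]).
   [Complete] carries a base point, so the space is nonempty. *)
#[short(type="completeMetricType")]
HB.structure Definition CompleteMetric (R : numDomainType) :=
  {X of CompletePseudoMetric R X & Metric R X}.

(* The restriction of an outer measure to its Caratheodory measurable sets.
   For a Borel regular mu, "mu-measurable" and integrals with respect to mu
   always refer to this (complete) measure. *)
Definition cara (R : realType) (X : pointedType)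
    (mu : {outer_measure set X -> \bar R}) :
    {measure set (caratheodory_type mu) -> \bar R} :=
  [the measure _ _ of (mu : set (caratheodory_type mu) -> \bar R)].

Section MetricMeasureSpaces.
Context {R : realType} {X : completeMetricType R}.
Implicit Types (mu nu : {outer_measure set X -> \bar R}) (f : X -> R).

Definition borel_regular mu : Prop :=
  (forall U : set X, open U -> mu.-caratheodory U) /\
  (forall A : set X, exists B : set X,
     [/\ <<s (@open X) >> B, A `<=` B & mu B = mu A]).

Definition separable : Prop :=
  exists D : set X, countable D /\ dense D.

Definition metric_measure_space mu : Prop :=
  [/\ separable, borel_regular mu &
      forall (x : X) (r : R), 0 < r -> (0 < mu (ball x r) < +oo)%E].

Definition locally_finite mu : Prop :=
  forall (x : X) (r : R), 0 < r -> (mu (ball x r) < +oo)%E.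

Definition measure_support mu : set X :=
  [set x | forall r : R, 0 < r -> (0 < mu (ball x r))%E].

Definition lipschitz_function f : Prop :=
  exists L : R, forall x y : X, `|f x - f y| <= L * mdist x y.

Definition lip f (x : X) : \bar R :=
  if x \in limit_point [set: X] then
    limf_esup (fun y : X => (`|f y - f x| / mdist y x)%:E) x^'
  else 0%E.

Definition average mu f (A : set X) : R :=
  (fine (mu A))^-1 * \int[cara mu]_(y in A) f y.

Definition eaverage mu (g : X -> \bar R) (A : set X) : \bar R :=
  ((mu A)^-1 * \int[cara mu]_(y in A) g y)%E.

Definition mean_oscillation mu (t : R) f (x : X) : \bar R :=
  eaverage mu (fun y => `|f y - average mu f (ball x t)|%:E) (ball x t).

Definition uniformly_locally_doubling mu : Prop :=
  forall R0 : R, 0 < R0 -> exists C : R, 0 < C /\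
    forall (x : X) (r : R), 0 < r <= R0 ->
      (mu (ball x (2 * r)) <= C%:E * mu (ball x r))%E.

Definition local_poincare mu (q : R) : Prop :=
  forall R0 : R, 0 < R0 -> exists C lambda : R, [/\ 0 < C, 1 <= lambda &
    forall f, lipschitz_function f -> forall (x : X) (r : R), 0 < r <= R0 ->
      (mean_oscillation mu r f x <=
       (C * r)%:E *
         eaverage mu (fun y => lip f y `^ q) (ball x (lambda * r)) `^ q^-1)%E].

Definition admissible mu (q : R) : Prop :=
  uniformly_locally_doubling mu /\ local_poincare mu q.

Definition L1loc mu f : Prop :=
  forall (x : X) (r : R), 0 < r -> (cara mu).-integrable (ball x r) (EFin \o f).

Definition besov_seminorm mu (s p : R) f : \bar R :=
  (\int[lebesgue_measure]_(t in `]0%R, 1%R[)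
     ((t `^ (- s))%:E * 'N[cara mu]_(p%:E)[mean_oscillation mu t f] *
      (t^-1)%:E))%E.

(* B^s_{p,1}(X) *)
Definition besov mu (s p : R) : set (X -> R) :=
  [set f | f \in Lfun (cara mu) p%:E /\ (besov_seminorm mu s p f < +oo)%E].

Definition besov_norm mu (s p : R) f : \bar R :=
  ('N[cara mu]_(p%:E)[EFin \o f] + besov_seminorm mu s p f)%E.

(* [phi] is only looked at on E. *)
Definition is_trace mu nu (E : set X) f (phi : X -> R) : Prop :=
  [/\ L1loc mu f,
      measurable_fun (E : set (caratheodory_type nu)) phi &
      {ae cara nu, forall x : X, E x ->
        eaverage mu (fun y => `|f y - phi x|%:E) (ball x r) @[r --> 0^'+]
          --> 0%E}].

Definition Lp_norm_on nu (E : set X) (p : R) (phi : X -> R) : \bar R :=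
  ((\int[cara nu]_(x in E) (`|phi x| `^ p)%:E) `^ p^-1)%E.

Definition trace_well_defined mu nu (E : set X) (F : set (X -> R)) : Prop :=
  forall f, F f -> exists phi : X -> R, is_trace mu nu E f phi.

(* Traces are nu-a.e. unique on E, and the norms do not distinguish a.e. equal
   functions, so quantifying over representatives is harmless. *)
Definition besov_trace_bounded mu nu (E : set X) (s p : R) : Prop :=
  exists C : R, 0 <= C /\
    forall f, besov mu s p f -> forall phi : X -> R, is_trace mu nu E f phi ->
      (Lp_norm_on nu E p phi <= C%:E * besov_norm mu s p f)%E.

Definition upper_codimension_regular mu nu (E : set X) (theta : R) : Prop :=
  exists C : R, 0 < C /\ forall (x : X) (r : R), E x -> 0 < r <= 1 ->
    (nu (ball x r `&` E) <= C%:E * (mu (ball x r) / (r `^ theta)%:E))%E.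

End MetricMeasureSpaces.

(* Main.v *)
Require Import Defs.
From mathcomp Require Import all_boot all_order all_algebra.
From mathcomp Require Import all_classical all_reals all_analysis.
From mathcomp Require Import measurable_realfun ring lra.
Import Order.TTheory GRing.Theory Num.Theory.
Import numFieldNormedType.Exports.
Local Open Scope classical_set_scope.
Local Open Scope ring_scope.

(** Put [s = theta / p] and test the trace inequality on a cutoff function. For
    [x] in [E] and [0 < r <= 1] let [f] be the function [bump x r], which is 1
    on [ball x r], 0 off [ball x (2 * r)] and Lipschitz with constant [r^-1]. A
    Lipschitz function is its own trace ([lipschitz_is_trace]), and [f = 1] on
    [ball x r], so [nu (ball x r `&` E)] is at most the integral of [|f| `^ p]
    over [E] with respect to [nu], hence at most the [p]-th power of a constant
    times the Besov norm of [f]. The theorem follows once this norm is shown to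
    be of order [r `^ (- s) * mu (ball x r) `^ p^-1] ([besov_norm_bump_le]),
    because [s * p = theta].

    For the seminorm, the [L_p] norm of the mean oscillation of [f] at scale [t]
    is bounded by a constant times [mu (ball x r) `^ p^-1 * Num.min 1 (t / r)].
    - For [t <= r] the oscillation is at most [2 * t / r] and vanishes off
      [ball x (3 * r)], whose measure is comparable with that of [ball x r]
      ([Lnorm_mean_oscillation_bump_small]).
    - For [t > r] the oscillation is at most twice the average of [f], which is
      at most [mu (ball x (2 * r)) / mu (ball y t)], and it vanishes off
      [ball x (3 * t)]. The resulting bound
      [mu (ball x (2 * r)) * mu (ball x (3 * t)) `^ (p^-1 - 1)] does not grow
      with [t], since [p >= 1] makes the last exponent nonpositive
      ([Lnorm_mean_oscillation_bump_large], [ler_powR_ratio]).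

    Integrating [Num.min 1 (t / r)] against [t `^ (- s - 1)] over the unit
    interval gives [r `^ (- s)] up to a constant, because [0 < s < 1]
    ([integral_powR_cut_le]). *)

(** * Integrals of powers of the variable *)

Lemma integral_powR (R : realType) (a b c : R) : 0 < a < b -> c != 0 ->
  (\int[lebesgue_measure]_(t in `[a, b]) (t `^ (c - 1))%:E =
   ((b `^ c - a `^ c) / c)%:E)%E.
Proof.
move=> /andP[a0 ab] c0.
have dF (d x : R) : 0 < x -> is_derive x 1 ((@powR R) ^~ d) (d * x `^ (d - 1)).
  by move=> x0; exact: is_derive1_powR.
have dG (x : R) : 0 < x ->
    is_derive x 1 (c^-1 \*: ((@powR R) ^~ c)) (x `^ (c - 1)).
  move=> x0; have d1 := dF c x x0; apply: is_derive_eq.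
  by rewrite /GRing.scale/= mulrA mulVf// mul1r.
have cont (f : R -> R) (x v : R) : is_derive x 1 f v -> {for x, continuous f}.
  by move=> df; apply: differentiable_continuous; apply/derivable1_diffP.
have gt0 (x : R) : x \in `[a, b] -> 0 < x.
  by rewrite in_itv/= => /andP[ax _]; exact: lt_le_trans ax.
rewrite (@continuous_FTC2 _ _ (c^-1 \*: ((@powR R) ^~ c)))//.
- by rewrite -EFinB /GRing.scale/= -mulrBr mulrC.
- apply: continuous_in_subspaceT => x; rewrite inE/= => xab.
  by apply: cont; apply: dF; exact: gt0.
- split.
  + move=> x xab; by case: (dG x (gt0 _ (subset_itv_oo_cc xab))).
  + by have := cont _ _ _ (dG a a0); exact: cvg_at_right_filter.
  + by have := cont _ _ _ (dG b (lt_trans a0 ab)); exact: cvg_at_left_filter.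
- move=> x xab.
  have := dG x (gt0 _ (subset_itv_oo_cc xab)).
  by move=> ?; rewrite derive1E derive_val.
Qed.

Lemma measurable_powR_EFin {R : realType} (D : set R) (c : R) :
  measurable_fun D (EFin \o (@powR R ^~ c)).
Proof. by apply/measurable_EFinP; exact: measurable_funTS. Qed.

(** The integrand blows up at 0 when [c < 1], so the integral over [[0, r]] is
    reached as a limit of integrals over compact subintervals. *)
Lemma ge0_integral_powR_le {R : realType} (c r : R) : 0 < c -> 0 < r ->
  (\int[lebesgue_measure]_(t in `]0%R, r]) (t `^ (c - 1))%:E <=
   (r `^ c / c)%:E)%E.
Proof.
move=> c0 r0.
(* the left endpoint starts at r / 2 so that every interval is nondegenerate *)
pose F n := (fun n => `[r * n.+2%:R^-1, r]%classic) n.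
have FE : `]0, r]%classic = \bigcup_n F n.
  apply/seteqP; split => x /=.
    rewrite in_itv/= => /andP[x0 xr].
    have rx : 0 < x / r by rewrite divr_gt0.
    have [n _ /= nx] := near_infty_natSinv_lt (PosNum rx).
    exists n => //; rewrite /F /= in_itv/= xr andbT mulrC -ler_pdivlMr//.
    apply/ltW; apply: le_lt_trans (nx n (leqnn _)).
    by rewrite lef_pV2 ?posrE// ler_nat.
  move=> [n _]; rewrite /F /= !in_itv/= => /andP[nx ->]; rewrite andbT.
  by apply: lt_le_trans nx; rewrite mulr_gt0.
rewrite FE.
have ndF : nondecreasing_seq F.
  apply/nondecreasing_seqP => n; rewrite subsetEset => x.
  rewrite /F /= !in_itv/=.
  move=> /andP[nx ->]; rewrite andbT; apply: le_trans nx.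
  by rewrite ler_pM2l// lef_pV2 ?posrE// ler_nat.
have cvg : (\int[lebesgue_measure]_(t in F n) (t `^ (c - 1))%:E @[n --> \oo] -->
    \int[lebesgue_measure]_(t in \bigcup_n F n) (t `^ (c - 1))%:E)%E.
  apply: ge0_nondecreasing_set_cvg_integral => // [i|i|i x _].
  - exact: measurable_itv.
  - exact: measurable_powR_EFin.
  - exact: powR_ge0.
rewrite -(cvg_lim _ cvg)//; apply: lime_le.
  by apply/cvg_ex; eexists; exact: cvg.
apply: nearW => n; rewrite integral_powR ?gt_eqF//.
  rewrite lee_fin ler_pM2r ?invr_gt0// gerBl; exact: powR_ge0.
by rewrite mulr_gt0//= gtr_pMr// invf_lt1// ltr1n.
Qed.

Lemma measurable_powR_cut {R : realType} (D : set R) (c r : R) :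
  measurable_fun D
    ((fun t => (t `^ c * (if t <= r then t / r else 1))%:E) : R -> \bar R).
Proof.
apply: measurable_funTS; apply/measurable_EFinP; apply: measurable_funM => //.
apply: measurable_fun_ifT => //; last exact: measurable_funM.
exact: measurable_fun_ler.
Qed.

(** With [c = - s - 1] the integrand is the weight of the Besov seminorm times
    the size of the oscillation, at scale [t], of a cutoff function living at
    scale [r]. Below [r] it is [t `^ (- s) / r], integrable at 0 because
    [s < 1]; above [r] it is [t `^ (- s - 1)], integrable at infinity because
    [0 < s]. Both pieces are of order [r `^ (- s)]. *)
Lemma integral_powR_cut_le {R : realType} (s r : R) : 0 < s < 1 -> 0 < r <= 1 ->
  (\int[lebesgue_measure]_(t in `]0%R, 1%R[)
     (t `^ (- s - 1) * (if t <= r then t / r else 1))%:E <=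
   (r `^ (- s) * ((1 - s)^-1 + s^-1))%:E)%E.
Proof.
move=> /andP[s0 s1] /andP[r0 r1].
pose g := fun t : R => (t `^ (- s - 1) * (if t <= r then t / r else 1))%:E.
have g0 t : 0 < t -> (0 <= g t)%E.
  move=> t0; rewrite lee_fin mulr_ge0 ?powR_ge0//; case: ifP => // _.
  by rewrite divr_ge0// ltW.
have g1 t : 0 < t <= r -> g t = (r^-1%:E * (t `^ (1 - s - 1))%:E)%E.
  move=> /andP[t0 tr]; rewrite /g tr -EFinM; congr EFin.
  have -> : 1 - s - 1 = (- s - 1) + 1 by ring.
  rewrite (@powRD _ t (- s - 1) 1) ?(gt_eqF t0) ?implybT// powRr1 ?ltW//; ring.
have g2 t : r < t -> g t = (t `^ (- s - 1))%:E.
  by move=> rt; rewrite /g leNgt rt/= mulr1.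
(* an endpoint beyond 1 keeps the second interval nondegenerate when r = 1 *)
apply: (@le_trans _ _
    (\int[lebesgue_measure]_(t in `]0%R, r] `|` `]r, 2%R]) g t)%E).
  apply: ge0_subset_integral => //.
  - exact: measurableU.
  - exact: measurable_powR_cut.
  - move=> x; rewrite /= !in_itv/= => -[|] /andP[x0 _]; apply: g0 => //.
    exact: lt_trans x0.
  - move=> x; rewrite /= !in_itv/= => /andP[x0 x1].
    by case: (leP x r) => xr; [left|right]; rewrite ?x0//; lra.
rewrite ge0_integral_setU//; last 3 first.
- exact: measurable_powR_cut.
- move=> x; rewrite /= !in_itv/= => -[|] /andP[x0 _]; apply: g0 => //.
  exact: lt_trans x0.
- apply/disj_setPS => x [] /=; rewrite !in_itv/= => /andP[_ xr] /andP[rx _].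
  by have := lt_le_trans rx xr; rewrite ltxx.
rewrite mulrDr EFinD; apply: leeD.
- under eq_integral => t /[!inE]/= /[!in_itv]/= /g1 -> do [].
  rewrite ge0_integralZl//; last 3 first.
  + exact: measurable_powR_EFin.
  + by move=> x _; rewrite lee_fin powR_ge0.
  + by rewrite lee_fin invr_ge0 ltW.
  have -> : r `^ (- s) / (1 - s) = r^-1 * (r `^ (1 - s) / (1 - s)).
    rewrite (@powRD _ r 1 (- s)) ?(gt_eqF r0) ?implybT// powRr1 ?ltW//.
    rewrite !mulrA mulVf ?gt_eqF//.
    by rewrite mul1r.
  rewrite EFinM; apply: lee_wpmul2l; first by rewrite lee_fin invr_ge0 ltW.
  by apply: ge0_integral_powR_le => //; lra.
- under eq_integral => t /[!inE]/= /[!in_itv]/= /andP[/g2 -> _] do [].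
  apply: (@le_trans _ _
      (\int[lebesgue_measure]_(t in `[r, 2%R]) (t `^ (- s - 1))%:E)%E).
    apply: ge0_subset_integral => //; first exact: measurable_powR_EFin.
      by move=> t _; rewrite lee_fin powR_ge0.
    by move=> t; rewrite /= !in_itv/= => /andP[rt t2]; rewrite (ltW rt).
  rewrite integral_powR ?oppr_eq0 ?gt_eqF//; last by lra.
  rewrite lee_fin invrN mulrN -mulNr opprB ler_pM2r ?invr_gt0// gerBl.
  exact: powR_ge0.
Qed.

(** * Monotonicity of integrals and bounds on norms *)

(** The integral of a nonnegative function is a supremum over the simple
    functions below it, so it is monotone without any measurability. This is
    what makes it possible to estimate the Besov seminorm: neither
    [x |-> mean_oscillation mu t f x] nor the dependence on [t] of its [L_p]
    norm is known to be measurable. *)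
Lemma le_nnintegral {d} {T : measurableType d} {R : realType}
    (m : {measure set T -> \bar R}) (f g : T -> \bar R) :
  (forall x, 0 <= f x)%E -> (forall x, f x <= g x)%E ->
  (\int[m]_x f x <= \int[m]_x g x)%E.
Proof.
move=> f0 fg; have g0 x := le_trans (f0 x) (fg x).
rewrite !ge0_integralTE//; apply: ereal_sup_le => _ [h hf <-].
by exists h => // x; exact: le_trans (fg x).
Qed.

Lemma le_nnintegral_in {d} {T : measurableType d} {R : realType}
    (m : {measure set T -> \bar R}) (D : set T) (f g : T -> \bar R) :
  (forall x, D x -> 0 <= f x)%E -> (forall x, D x -> f x <= g x)%E ->
  (\int[m]_(x in D) f x <= \int[m]_(x in D) g x)%E.
Proof.
move=> f0 fg; rewrite !(integral_mkcond D); apply: le_nnintegral => x.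
  exact: erestrict_ge0.
exact: lee_restrict.
Qed.

Lemma Lnorm_le {d} {T : measurableType d} {R : realType}
    (m : {measure set T -> \bar R}) (p k : R) (A : set T) (g : T -> \bar R) :
  0 < p -> 0 <= k -> measurable A ->
  (forall x, 0 <= g x)%E -> (forall x, A x -> g x <= k%:E)%E ->
  (forall x, ~ A x -> g x = 0)%E ->
  ('N[m]_(p%:E)[g] <= k%:E * m A `^ p^-1)%E.
Proof.
move=> p0 k0 mA g0 gk gA; rewrite unlock.
have -> : (k%:E * m A `^ p^-1 = ((k `^ p)%:E * m A) `^ p^-1)%E.
  rewrite poweRM ?lee_fin ?powR_ge0//.
  by rewrite poweR_EFin -powRrM divff ?gt_eqF// powRr1.
apply: gt0_ler_poweR; rewrite ?invr_ge0 ?(ltW p0)// ?in_itv/= ?leey ?andbT.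
- by apply: integral_ge0 => x _; exact: poweR_ge0.
- by rewrite mule_ge0// lee_fin powR_ge0.
rewrite -(integral_cst m mA) [leRHS]integral_mkcond.
apply: le_nnintegral => x; first exact: poweR_ge0.
rewrite patchE; case: ifPn => [/[!inE] Ax|/negP/[!inE] /gA ->].
  rewrite gee0_abs// -poweR_EFin; apply: gt0_ler_poweR; rewrite ?(ltW p0)//.
  - by rewrite in_itv/= g0 leey.
  - by rewrite in_itv/= lee_fin k0 leey.
  - exact: gk.
by rewrite abse0 poweR0r// gt_eqF.
Qed.

(** Since [a / b <= 1] and [1 - q >= 0], one has
    [a / b = (a / b) `^ q * (a / b) `^ (1 - q) <= (a / b) `^ q]. *)
Lemma ler_powR_ratio {R : realType} (a b q : R) : 0 < a <= b -> q <= 1 ->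
  a / b * b `^ q <= a `^ q.
Proof.
move=> /andP[a0 ab] q1; have b0 := lt_le_trans a0 ab.
rewrite mulrAC ler_pdivrMr//.
have split_pow c : 0 < c -> c = c `^ (1 - q) * c `^ q.
  move=> c0; rewrite -powRD ?(gt_eqF c0) ?implybT//.
  by rewrite addrNK powRr1 ?ltW.
rewrite {1}(split_pow _ a0) {2}(split_pow _ b0).
rewrite [leLHS](_ : _ = a `^ q * b `^ q * a `^ (1 - q)); last by ring.
rewrite [leRHS](_ : _ = a `^ q * b `^ q * b `^ (1 - q)); last by ring.
rewrite ler_wpM2l ?mulr_ge0 ?powR_ge0//.
by apply: ge0_ler_powR; rewrite ?nnegrE ?(ltW a0) ?(ltW b0) ?subr_ge0.
Qed.

(** * Averages and mean oscillation on balls *)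

Lemma open_measurable_cara {R : realType} {X : completeMetricType R}
    (mu : {outer_measure set X -> \bar R}) (U : set X) :
  borel_regular mu -> open U -> measurable (U : set (caratheodory_type mu)).
Proof. by move=> [+ _]; apply. Qed.

Lemma continuous_measurable_cara {R : realType} {X : completeMetricType R}
    (mu : {outer_measure set X -> \bar R}) (f : X -> R) :
  borel_regular mu -> continuous f ->
  measurable_fun [set: caratheodory_type mu] (f : caratheodory_type mu -> R).
Proof.
move=> mu_br cf;
  apply: (@measurability _ _ (caratheodory_type mu) R _ f _
    (RGenOpens.measurableE R)).
move=> _ [_ [a [b ->] <-]]; rewrite setTI.
by apply: open_measurable_cara => //; exact: open_comp.
Qed.

Lemma average_between {R : realType} {X : completeMetricType R}
    (mu : {outer_measure set X -> \bar R}) (f : X -> R) (A : set X) (a b : R) :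
  measurable (A : set (caratheodory_type mu)) -> (0 < mu A < +oo)%E ->
  (cara mu).-integrable A (EFin \o f) -> (forall y, A y -> a <= f y <= b) ->
  a <= average mu f A <= b.
Proof.
move=> mA /andP[A0 Aoo] If fab.
have A_gt0 : 0 < fine (mu A) by rewrite fine_gt0// A0.
have Icst c : (cara mu).-integrable A (EFin \o cst c).
  apply: measurable_bounded_integrable => //.
  by exists `|c|; split => // x cx y _ /=; exact: ltW.
rewrite /average ler_pdivlMl// ler_pdivrMl// ![fine _ * _]mulrC.
rewrite -!(Rintegral_cst (cara mu) mA).
apply/andP; split; apply: le_Rintegral => //; try exact: Icst.
  by move=> y /fab/andP[].
by move=> y /fab/andP[].
Qed.

Lemma eaverage_le {R : realType} {X : completeMetricType R}
    (mu : {outer_measure set X -> \bar R}) (g : X -> \bar R) (A : set X)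
    (c : R) :
  measurable (A : set (caratheodory_type mu)) -> (0 < mu A < +oo)%E ->
  (forall y, A y -> 0 <= g y <= c%:E)%E -> (eaverage mu g A <= c%:E)%E.
Proof.
move=> mA /andP[A0 Aoo] gc.
have muA : mu A \is a fin_num by rewrite ge0_fin_numE// ltW.
rewrite /eaverage.
apply: (@le_trans _ _ ((mu A)^-1 * (c%:E * mu A))%E).
  apply: lee_wpmul2l; first by rewrite inve_ge0 ltW.
  rewrite -(integral_cst (cara mu) mA).
  by apply: le_nnintegral_in => y /gc/andP[].
rewrite muleCA mulVe ?mule1// ?gt_eqF//.
Qed.

Lemma metric_ball_open {R : realType} {X : completeMetricType R} (x : X)
    (r : R) :
  open (ball x r).
Proof.
rewrite openE => y /=; rewrite ballEmdist/= => xy.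
apply/nbhs_ballP; exists (r - mdist x y); first by rewrite /= subr_gt0.
move=> z; rewrite !ballEmdist/= => yz.
by have := metric_triangle x y z; lra.
Qed.

Lemma lipschitz_continuous {R : realType} {X : completeMetricType R}
    (L : R) (f : X -> R) :
  (forall y z, `|f y - f z| <= L * mdist y z) -> continuous f.
Proof.
move=> fL x; apply/cvgrPdist_lt => e e0.
have L1 : 0 < `|L| + 1 by rewrite ltr_wpDl.
apply/nbhs_ballP; exists (e / (`|L| + 1)); first by rewrite /= divr_gt0.
move=> z; rewrite ballEmdist/= ltr_pdivlMr// => xz.
apply: le_lt_trans (fL x z) _; apply: le_lt_trans xz.
rewrite mulrC ler_wpM2l ?mdist_ge0//; have := ler_norm L; lra.
Qed.

Section MetricMeasure.
Context {R : realType} {X : completeMetricType R}.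
Context {mu : {outer_measure set X -> \bar R}} (mms : metric_measure_space mu).
Implicit Types (f : X -> R) (x : X) (r t : R).

Lemma measurable_ball_cara x r :
  measurable (ball x r : set (caratheodory_type mu)).
Proof.
by case: mms => _ mu_br _; exact/open_measurable_cara/metric_ball_open.
Qed.

Lemma ball_gt0_lty x r : 0 < r -> (0 < mu (ball x r) < +oo)%E.
Proof. by case: mms => _ _; exact. Qed.

Lemma bounded_continuous_L1loc f (M : R) :
  continuous f -> (forall y, `|f y| <= M) -> L1loc mu f.
Proof.
move=> cf fM x r r0; have /andP[_ xr] := ball_gt0_lty x r r0.
apply: measurable_bounded_integrable => //; first exact: measurable_ball_cara.
  apply: measurable_funTS; apply: continuous_measurable_cara => //.
  by case: mms.
exists M; split => [|N MN y _].
  by apply: ger0_real; exact: le_trans (fM x).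
by apply: le_trans (fM y) _; exact: ltW.
Qed.

(** The average of [f] over a ball on which [f] varies by at most [c] is within
    [c] of every value of [f] on that ball. *)
Lemma mean_oscillation_le_diameter f x t (c : R) : L1loc mu f -> 0 < t ->
  (forall y z, ball x t y -> ball x t z -> `|f y - f z| <= c) ->
  (mean_oscillation mu t f x <= c%:E)%E.
Proof.
move=> Lf t0 fc; apply: eaverage_le.
- exact: measurable_ball_cara.
- exact: ball_gt0_lty.
move=> y xy; rewrite !lee_fin normr_ge0/=.
have /andP[] : f y - c <= average mu f (ball x t) <= f y + c.
  apply: average_between;
    [exact: measurable_ball_cara|exact: ball_gt0_lty|exact: Lf|].
  by move=> z xz; have := fc y z xy xz; rewrite ler_norml; lra.
by move=> *; rewrite ler_norml; lra.
Qed.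

(** Triangle inequality: the average of [|f - a|] is at most the average of
    [f] plus [a], where [a] is the average of [f]. *)
Lemma mean_oscillation_le_average f x t : L1loc mu f -> 0 < t ->
  (forall y, 0 <= f y) ->
  (mean_oscillation mu t f x <= (2 * average mu f (ball x t))%:E)%E.
Proof.
move=> Lf t0 f0; have mB := measurable_ball_cara x t.
have /andP[B0 Boo] := ball_gt0_lty x t t0.
set a := average mu f _.
have Bfin : mu (ball x t) \is a fin_num by rewrite ge0_fin_numE// ltW.
have If : (\int[cara mu]_(y in ball x t) (f y)%:E =
    (a * fine (mu (ball x t)))%:E)%E.
  rewrite /a /average mulrC mulrA divff ?mul1r ?gt_eqF ?fine_gt0 ?B0//.
  by rewrite /Rintegral fineK//; apply: integrable_fin_num => //; exact: Lf.
have a0 : 0 <= a.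
  rewrite /a /average /Rintegral mulr_ge0//.
    by rewrite invr_ge0 fine_ge0 ?(ltW B0).
  by rewrite fine_ge0// integral_ge0// => y _; rewrite lee_fin.
rewrite /mean_oscillation /eaverage.
apply: (@le_trans _ _ ((mu (ball x t))^-1 * ((2 * a)%:E * mu (ball x t)))%E).
  apply: lee_wpmul2l; first by rewrite inve_ge0 ltW.
  apply: (@le_trans _ _ (\int[cara mu]_(y in ball x t) ((f y)%:E + a%:E))%E).
    apply: le_nnintegral_in => y _; rewrite -?EFinD lee_fin//.
    by apply: le_trans (ler_normB _ _) _; rewrite !ger0_norm.
  rewrite ge0_integralD//; last 2 first.
  - by move=> y _; rewrite lee_fin.
  - exact: measurable_int (Lf x t t0).
  rewrite If EFinM fineK// integral_cst// [(2 * a)%R]mulr_natl mulr2n EFinD.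
  by rewrite ge0_muleDl ?lee_fin.
by rewrite muleCA mulVe ?mule1// ?gt_eqF.
Qed.

(** On [ball x r] a Lipschitz function differs from its value at [x] by at most
    [|L| * r], so the limit defining the trace is 0 at every point. *)
Lemma lipschitz_is_trace (nu : {outer_measure set X -> \bar R}) (E : set X)
    f (L M : R) :
  borel_regular nu ->
  (forall y z, `|f y - f z| <= L * mdist y z) -> (forall y, `|f y| <= M) ->
  is_trace mu nu E f f.
Proof.
move=> nu_br fL fM; have cf := lipschitz_continuous _ _ fL.
split; first exact: bounded_continuous_L1loc fM.
  by apply: measurable_funTS; exact: continuous_measurable_cara.
apply: aeW => x _.
have : (`|L|%:E * r%:E)%E @[r --> 0^'+] --> 0%E.
  rewrite -(mule0 `|L|%:E); apply: cvgeMl => //.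
  apply: cvg_EFin; first exact: nearW.
  by apply: cvg_at_right_filter; exact: cvg_id.
apply: squeeze_cvge; last exact: cvg_cst.
near=> r; have r0 : 0 < r by [].
apply/andP; split.
  apply: mule_ge0.
    by rewrite inve_ge0; have /andP[/ltW] := ball_gt0_lty x r r0.
  by apply: integral_ge0 => y _; rewrite lee_fin.
rewrite -EFinM; apply: eaverage_le.
- exact: measurable_ball_cara.
- exact: ball_gt0_lty.
move=> y; rewrite ballEmdist/= => xy; rewrite !lee_fin normr_ge0/=.
apply: le_trans (fL y x) _; rewrite metric_sym.
apply: le_trans (ler_wpM2r (mdist_ge0 _ _) (ler_norm L)) _.
by rewrite ler_wpM2l// ltW.
Unshelve. all: by end_near. Qed.
End MetricMeasure.

(** * A Lipschitz cutoff function *)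

Definition bump {R : realType} {X : completeMetricType R} (x : X) (r : R)
    (y : X) : R :=
  Num.max 0 (Num.min 1 (2 - mdist x y / r)).

Section Bump.
Context {R : realType} {X : completeMetricType R}.
Implicit Types (x y z : X) (r : R).

Lemma bump_ge0 x r y : 0 <= bump x r y.
Proof. by rewrite /bump le_max lexx. Qed.

Lemma bump_le1 x r y : bump x r y <= 1.
Proof. by rewrite /bump ge_max ler01 ge_min lexx. Qed.

Lemma bump_eq1 x r y : 0 < r -> ball x r y -> bump x r y = 1.
Proof.
move=> r0; rewrite ballEmdist/= => xy; rewrite /bump.
have : mdist x y / r <= 1 by rewrite ler_pdivrMr// mul1r ltW.
by move=> h; rewrite min_l ?max_r//; lra.
Qed.

Lemma bump_eq0 x r y : 0 < r -> ~ ball x (2 * r) y -> bump x r y = 0.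
Proof.
move=> r0; rewrite ballEmdist/= => /negP; rewrite -leNgt => xy; rewrite /bump.
have h : 2 <= mdist x y / r by rewrite ler_pdivlMr.
by rewrite min_r ?max_l//; lra.
Qed.

Lemma bump_lipschitz x r y z : 0 < r ->
  `|bump x r y - bump x r z| <= r^-1 * mdist y z.
Proof.
move=> r0; have clamp (a b : R) :
    `|Num.max 0 (Num.min 1 a) - Num.max 0 (Num.min 1 b)| <= `|a - b|.
  have h1 := ler_norm (a - b); have h2 := ler_norm (b - a).
  rewrite distrC in h2; rewrite ler_norml.
  by apply/andP; split; case: (leP 1 a) => ?; case: (leP 1 b) => ?;
    case: (leP 0 a) => ?; case: (leP 0 b) => ?;
    rewrite ?(max_r ler01) ?max_r ?max_l//; lra.
apply: le_trans (clamp _ _) _.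
have -> : 2 - mdist x y / r - (2 - mdist x z / r) =
  r^-1 * (mdist x z - mdist x y) by ring.
rewrite normrM gtr0_norm ?invr_gt0// ler_wpM2l ?invr_ge0 ?(ltW r0)//.
have h1 := metric_triangle x y z; have h2 := metric_triangle x z y.
rewrite (metric_sym z y) in h2; rewrite ler_norml; lra.
Qed.

End Bump.

(** * The Besov norm of the cutoff function *)

Section BumpBesov.
Context {R : realType} {X : completeMetricType R}.
Context {mu : {outer_measure set X -> \bar R}} (mms : metric_measure_space mu).
Implicit Types (x y : X) (r t : R).

Let m x r : R := fine (mu (ball x r)).

Let ball_fin x r : 0 < r -> mu (ball x r) = (m x r)%:E.
Proof.
move=> r0; have /andP[/ltW B0 Boo] := ball_gt0_lty mms x r r0.
by rewrite fineK// ge0_fin_numE.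
Qed.

Let m_gt0 x r : 0 < r -> 0 < m x r.
Proof. by move=> r0; rewrite fine_gt0// ball_gt0_lty. Qed.

Let m_le x r y (s : R) : 0 < r -> 0 < s -> mdist y x + r <= s -> m x r <= m y s.
Proof.
move=> r0 s0 h; rewrite -lee_fin -!ball_fin//; apply: le_outer_measure => z.
rewrite !ballEmdist/= => xz; have := metric_triangle y x z; lra.
Qed.

Lemma average_le_support (f : X -> R) (A : set X) x t :
  measurable (A : set (caratheodory_type mu)) -> (mu A < +oo)%E -> 0 < t ->
  (forall y, 0 <= f y <= 1) -> (forall y, ~ A y -> f y = 0) ->
  average mu f (ball x t) <= fine (mu A) / m x t.
Proof.
move=> mA Aoo t0 f01 fA; rewrite /average -/(m x t) mulrC.
rewrite ler_wpM2r ?invr_ge0 ?(ltW (m_gt0 _ _ t0))//.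
have h : (\int[cara mu]_(y in ball x t) (f y)%:E <= mu A)%E.
  rewrite -[leRHS]mul1e -(integral_cst (cara mu) mA).
  rewrite [leLHS]integral_mkcond [leRHS]integral_mkcond.
  apply: le_nnintegral => y; have /andP[f0 f1] := f01 y; rewrite !patchE.
    by case: ifPn => // _; rewrite lee_fin.
  case: ifPn => _; case: ifPn => [_|/negP/[!inE] /fA]; rewrite /= ?lee_fin//.
  by move=> ->.
rewrite /Rintegral fine_le//; last first.
  by rewrite ge0_fin_numE// (le_trans _ h)// integral_ge0// => y _;
    rewrite lee_fin; have /andP[] := f01 y.
rewrite ge0_fin_numE ?(le_lt_trans h)// integral_ge0// => y _.
by rewrite lee_fin; have /andP[] := f01 y.
Qed.

Lemma mean_oscillation_ge0 t (f : X -> R) x : 0 < t ->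
  (0 <= mean_oscillation mu t f x)%E.
Proof.
move=> t0; apply: mule_ge0.
  by rewrite inve_ge0; have /andP[/ltW] := ball_gt0_lty mms x t t0.
by apply: integral_ge0 => y _; rewrite lee_fin.
Qed.

(* doubling is applied below at radii up to 4 * t, where t < 1 *)
Context {D : R} (D1 : 1 <= D)
  (dbl : forall x r, 0 < r <= 4 -> m x (2 * r) <= D * m x r).

Let D_ge0 : 0 <= D. Proof. exact: le_trans D1. Qed.

Let dbl2 x r : 0 < r <= 2 -> m x (4 * r) <= D ^+ 2 * m x r.
Proof.
move=> /andP[r0 r2]; have -> : 4 * r = 2 * (2 * r) by ring.
apply: le_trans (dbl x (2 * r) _) _; first by lra.
by rewrite expr2 -mulrA ler_wpM2l// dbl//; lra.
Qed.

Let dbl3 x r : 0 < r <= 1 -> m x (8 * r) <= D ^+ 3 * m x r.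
Proof.
move=> /andP[r0 r1]; have -> : 8 * r = 4 * (2 * r) by ring.
apply: le_trans (dbl2 x (2 * r) _) _; first by lra.
by rewrite (exprSr D 2) -mulrA ler_wpM2l ?exprn_ge0// dbl//; lra.
Qed.

Context (p : R) (p1 : 1 <= p).

Let p0 : 0 < p. Proof. exact: lt_le_trans p1. Qed.
Let q1 : p^-1 <= 1. Proof. by rewrite invf_le1. Qed.
Let q0 : 0 <= p^-1. Proof. by rewrite invr_ge0 ltW. Qed.

Let root_le (a b c : R) : 1 <= c -> 0 <= a -> 0 <= b -> a <= c * b ->
  a `^ p^-1 <= c * b `^ p^-1.
Proof.
move=> c1 a0 b0 abc; have c0 : 0 <= c by exact: le_trans c1.
apply: (@le_trans _ _ ((c * b) `^ p^-1)).
  by apply: ge0_ler_powR; rewrite ?nnegrE ?mulr_ge0.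
rewrite powRM// ler_wpM2r ?powR_ge0//; exact: ler1_powR.
Qed.

Let bump_L1loc x r : 0 < r -> L1loc mu (bump x r).
Proof.
move=> r0; apply: (bounded_continuous_L1loc mms _ 1).
  by apply: (lipschitz_continuous r^-1) => y z; exact: bump_lipschitz.
by move=> y; rewrite ger0_norm ?bump_ge0 ?bump_le1.
Qed.

Lemma Lnorm_bump_le x r : 0 < r <= 1 ->
  ('N[cara mu]_(p%:E)[EFin \o bump x r] <= (D * m x r `^ p^-1)%:E)%E.
Proof.
move=> /andP[r0 r1].
apply: (@le_trans _ _ (1%:E * mu (ball x (2 * r)) `^ p^-1)%E).
  apply: Lnorm_le => //.
  - exact: measurable_ball_cara.
  - by move=> y; rewrite lee_fin bump_ge0.
  - by move=> y _; rewrite lee_fin bump_le1.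
  - by move=> y ?; rewrite /= bump_eq0.
rewrite mul1e ball_fin ?mulr_gt0// poweR_EFin lee_fin.
apply: root_le => //; rewrite ?(ltW (m_gt0 _ _ _)) ?mulr_gt0//.
by apply: dbl; lra.
Qed.

Lemma mean_oscillation_bump_eq0 x r t y : 0 < r -> 0 < t ->
  ~ ball x (2 * r + t) y -> mean_oscillation mu t (bump x r) y = 0%E.
Proof.
move=> r0 t0 xy; apply/eqP; rewrite eq_le mean_oscillation_ge0// andbT.
apply: mean_oscillation_le_diameter => //; first exact: bump_L1loc.
have far z : ball y t z -> bump x r z = 0.
  move=> yz; apply: bump_eq0 => // xz; apply: xy; move: xz yz.
  rewrite !ballEmdist/= => xz yz.
  by have := metric_triangle x z y; rewrite (metric_sym z y); lra.
by move=> z w /far -> /far ->; rewrite subrr normr0.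
Qed.

(** At a scale [t] below [r] the Lipschitz bound controls the oscillation by
    [2 * t / r], and only points of [ball x (3 * r)] see the support. *)
Lemma Lnorm_mean_oscillation_bump_small x r t : 0 < t <= r -> r <= 1 ->
  ('N[cara mu]_(p%:E)[mean_oscillation mu t (bump x r)] <=
   (2 * D ^+ 2 * m x r `^ p^-1 * (t / r))%:E)%E.
Proof.
move=> /andP[t0 tr] r1; have r0 := lt_le_trans t0 tr.
apply: (@le_trans _ _ ((2 * (t / r))%:E * mu (ball x (3 * r)) `^ p^-1)%E).
  apply: Lnorm_le => //.
  - by rewrite mulr_ge0// divr_ge0// ltW.
  - exact: measurable_ball_cara.
  - by move=> y; exact: mean_oscillation_ge0.
  - move=> y _; apply: mean_oscillation_le_diameter => //.
      exact: bump_L1loc.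
    move=> z w; rewrite !ballEmdist/= => yz yw.
    apply: le_trans (bump_lipschitz x r z w r0) _.
    rewrite mulrC mulrA ler_wpM2r ?invr_ge0 ?(ltW r0)//.
    by have := metric_triangle z y w; rewrite (metric_sym z y); lra.
  - move=> y xy; apply: mean_oscillation_bump_eq0 => //.
    by move=> xy'; apply: xy; move: xy'; rewrite !ballEmdist/=; lra.
rewrite ball_fin ?mulr_gt0// poweR_EFin -EFinM lee_fin.
rewrite [leRHS](_ : _ = 2 * (t / r) * (D ^+ 2 * m x r `^ p^-1)); last by ring.
rewrite ler_wpM2l ?mulr_ge0 ?invr_ge0 ?(ltW r0) ?(ltW t0)//.
apply: root_le; rewrite ?exprn_ege1 ?(ltW (m_gt0 _ _ _)) ?mulr_gt0//.
apply: le_trans (dbl2 x r _); last by lra.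
by apply: m_le; rewrite ?mulr_gt0// mdistxx; lra.
Qed.

(** At a scale [t] above [r] the oscillation at [y] is at most twice the
    average, that is at most twice [mu (ball x (2 * r)) / mu (ball y t)]; by
    doubling the denominator is comparable with [mu (ball x (3 * t))], and the
    points [y] where the oscillation is nonzero lie in this same ball. *)
Lemma Lnorm_mean_oscillation_bump_large x r t : 0 < r < t -> t < 1 ->
  ('N[cara mu]_(p%:E)[mean_oscillation mu t (bump x r)] <=
   (2 * D ^+ 4 * m x r `^ p^-1)%:E)%E.
Proof.
move=> /andP[r0 rt] t1; have t0 := lt_trans r0 rt.
have t30 : 0 < 3 * t by rewrite mulr_gt0.
have r20 : 0 < 2 * r by rewrite mulr_gt0.
have k0 : 0 <= 2 * (D ^+ 3 * (m x (2 * r) / m x (3 * t))).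
  by rewrite !mulr_ge0 ?invr_ge0 ?exprn_ge0// ltW// m_gt0.
apply: (@le_trans _ _ ((2 * (D ^+ 3 * (m x (2 * r) / m x (3 * t))))%:E *
    mu (ball x (3 * t)) `^ p^-1)%E).
  apply: Lnorm_le => //.
  - exact: measurable_ball_cara.
  - by move=> y; exact: mean_oscillation_ge0.
  - move=> y; rewrite ballEmdist/= => xy.
    apply: le_trans (mean_oscillation_le_average mms _ _ _
      (bump_L1loc x r r0) t0 _) _.
      exact: bump_ge0.
    rewrite lee_fin ler_wpM2l//.
    apply: le_trans (average_le_support _ (ball x (2 * r)) _ _ _ _ t0 _ _) _.
    + exact: measurable_ball_cara.
    + by have /andP[] := ball_gt0_lty mms x (2 * r) r20.
    + by move=> z; rewrite bump_ge0 bump_le1.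
    + by move=> z; exact: bump_eq0.
    rewrite -/(m _ _) mulrCA ler_wpM2l ?(ltW (m_gt0 _ _ _))//.
    (* ball x (3 * t) is included in ball y (6 * t), hence in ball y (8 * t) *)
    rewrite ler_pdivlMr ?m_gt0// mulrC ler_pdivrMr ?m_gt0//.
    apply: le_trans (dbl3 y t _); last by lra.
    by apply: m_le; rewrite ?mulr_gt0// metric_sym; lra.
  - move=> y xy; apply: mean_oscillation_bump_eq0 => //.
    by move=> xy'; apply: xy; move: xy'; rewrite !ballEmdist/=; lra.
rewrite ball_fin// poweR_EFin -EFinM lee_fin.
rewrite [leLHS](_ : _ = 2 * D ^+ 3 *
  (m x (2 * r) / m x (3 * t) * m x (3 * t) `^ p^-1)); last by ring.
rewrite [leRHS](_ : _ = 2 * D ^+ 3 * (D * m x r `^ p^-1)); last by ring.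
rewrite ler_wpM2l ?mulr_ge0 ?exprn_ge0//.
apply: le_trans (ler_powR_ratio _ _ _ _ q1) _.
  rewrite m_gt0//=; apply: m_le => //; rewrite mdistxx; lra.
apply: root_le => //; rewrite ?(ltW (m_gt0 _ _ _))//.
by apply: dbl; lra.
Qed.

Lemma besov_seminorm_bump_le (s : R) x r : 0 < s < 1 -> 0 < r <= 1 ->
  (besov_seminorm mu s p (bump x r) <=
   (2 * D ^+ 4 * m x r `^ p^-1 * (r `^ (- s) * ((1 - s)^-1 + s^-1)))%:E)%E.
Proof.
move=> s01 /andP[r0 r1].
set K := 2 * D ^+ 4 * m x r `^ p^-1.
have K0 : 0 <= K by rewrite !mulr_ge0 ?exprn_ge0 ?powR_ge0.
have N_le t : 0 < t < 1 ->
    ('N[cara mu]_(p%:E)[mean_oscillation mu t (bump x r)] <=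
     (K * (if (t <= r)%R then t / r else 1))%:E)%E.
  move=> /andP[t0 t1]; case: (leP t r) => tr.
    apply: le_trans (Lnorm_mean_oscillation_bump_small x r t _ _) _;
      rewrite ?t0//.
    rewrite lee_fin ler_wpM2r//; first by rewrite divr_ge0 ?ltW.
    by rewrite ler_wpM2r ?powR_ge0// ler_wpM2l// ler_weXn2l.
  by rewrite mulr1; apply: Lnorm_mean_oscillation_bump_large; rewrite ?r0.
rewrite /besov_seminorm.
apply: (@le_trans _ _ (\int[lebesgue_measure]_(t in `]0%R, 1%R[)
     (K%:E * (t `^ (- s - 1) * (if (t <= r)%R then t / r else 1))%:E))%E).
  apply: le_nnintegral_in => t; rewrite /= in_itv/= => /andP[t0 t1].
    by rewrite !mule_ge0// ?lee_fin ?powR_ge0 ?invr_ge0 ?(ltW t0)// Lnorm_ge0.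
  rewrite muleAC -EFinM powRB ?(gt_eqF t0) ?implybT// powRr1 ?(ltW t0)//.
  rewrite [leRHS](_ : _ = ((t `^ (- s) / t)%:E *
      (K * (if (t <= r)%R then t / r else 1))%:E)%E); last first.
    by rewrite -!EFinM mulrCA.
  apply: lee_wpmul2l; last by apply: N_le; rewrite t0.
  by rewrite lee_fin divr_ge0 ?powR_ge0 ?ltW.
rewrite ge0_integralZl//; last 2 first.
- exact: measurable_powR_cut.
- move=> t; rewrite /= in_itv/= => /andP[t0 _].
  rewrite lee_fin mulr_ge0 ?powR_ge0//.
  by case: ifP => // _; rewrite divr_ge0 ?ltW.
rewrite [leRHS]EFinM; apply: lee_wpmul2l; first by rewrite lee_fin.
by apply: integral_powR_cut_le; rewrite ?r0.
Qed.

Lemma bump_in_Lfun x r : 0 < r <= 1 -> bump x r \in Lfun (cara mu) p%:E.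
Proof.
move=> /[dup] r01 /andP[r0 _]; rewrite inE; apply/andP; split; rewrite inE/=.
  apply: continuous_measurable_cara; first by case: mms.
  by apply: (lipschitz_continuous r^-1) => y z; exact: bump_lipschitz.
rewrite /finite_norm; apply: le_lt_trans (ltry _); exact: Lnorm_bump_le.
Qed.

Lemma besov_norm_bump_le (s : R) x r : 0 < s < 1 -> 0 < r <= 1 ->
  (besov_norm mu s p (bump x r) <=
   ((D + 2 * D ^+ 4 * ((1 - s)^-1 + s^-1)) *
    (r `^ (- s) * m x r `^ p^-1))%:E)%E.
Proof.
move=> s01 r01; apply: le_trans (leeD (Lnorm_bump_le x r r01)
  (besov_seminorm_bump_le s x r s01 r01)) _.
rewrite -EFinD lee_fin [leRHS]mulrDl; apply: lerD.
  rewrite ler_wpM2l// ler_peMl ?powR_ge0//.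
  move: r01 => /andP[r0 r1]; rewrite powRN invf_ge1 ?powR_gt0//.
  have -> : 1 = 1 `^ s :> R by rewrite powR1.
  by apply: ge0_ler_powR; rewrite ?nnegrE//; lra.
rewrite [leLHS](_ : _ = 2 * D ^+ 4 * ((1 - s)^-1 + s^-1) *
  (r `^ (- s) * m x r `^ p^-1))//; by ring.
Qed.
End BumpBesov.

(** Any larger constant is also a doubling constant; one that is at least 1
    dominates its own powers of exponent at most 1, which is how the [p]-th
    roots of doubling constants are absorbed. *)
Lemma doubling_ge1 {R : realType} {X : completeMetricType R}
    (mu : {outer_measure set X -> \bar R}) (R0 : R) :
  metric_measure_space mu -> uniformly_locally_doubling mu -> 0 < R0 ->
  exists2 D : R, 1 <= D & forall (x : X) (r : R), 0 < r <= R0 ->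
    fine (mu (ball x (2 * r))) <= D * fine (mu (ball x r)).
Proof.
move=> mms dbl R00; have [C [C0 HC]] := dbl R0 R00.
exists (Num.max 1 C) => [|x r rR]; first by rewrite le_max lexx.
have /andP[r0 _] := rR.
have r20 : 0 < 2 * r by rewrite mulr_gt0.
have fin t : 0 < t -> mu (ball x t) = (fine (mu (ball x t)))%:E.
  move=> t0; have /andP[/ltW B0 Boo] := ball_gt0_lty mms x t t0.
  by rewrite fineK// ge0_fin_numE.
have := HC x r rR; rewrite (fin _ r0) (fin _ r20) -EFinM lee_fin.
move=> /le_trans; apply; rewrite ler_wpM2r ?fine_ge0//.
by rewrite le_max lexx orbT.
Qed.

(** * Codimension bound *)

Theorem theorem1p3 (R : realType) (p : R) (p_ge1 : 1 <= p)
    (X : completeMetricType R) (mu : {outer_measure set X -> \bar R})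
    (X_mms : metric_measure_space mu) (X_adm : admissible mu p)
    (E : set X) (E_closed : closed E)
    (nu : {outer_measure set X -> \bar R})
    (nu_lf : locally_finite nu) (nu_br : borel_regular nu)
    (nu_supp : measure_support nu `<=` E)
    (theta : R) (theta_bnd : 0 < theta < p)
    (Tr_def : trace_well_defined mu nu E (besov mu (theta / p) p))
    (Tr_bnd : besov_trace_bounded mu nu E (theta / p) p) :
  upper_codimension_regular mu nu E theta.
Proof.
have p0 : 0 < p by exact: lt_le_trans p_ge1.
have p_neq0 : p != 0 by rewrite gt_eqF.
have s01 : 0 < theta / p < 1.
  by move: theta_bnd => /andP[t0 tp]; rewrite divr_gt0//= ltr_pdivrMr// mul1r.
have [D D1 dbl] := doubling_ge1 mu 4 X_mms X_adm.1 (ltr0Sn R 3).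
have [C [C0 HC]] := Tr_bnd.
pose s := theta / p.
pose K := D + 2 * D ^+ 4 * ((1 - s)^-1 + s^-1).
(* adding 1 makes the constant positive even when C = 0 *)
exists ((C * K) `^ p + 1); split=> [|x r Ex r01].
  by rewrite ltr_wpDl ?powR_ge0.
have /andP[r0 r1] := r01.
set f := bump x r.
have /andP[B0 Boo] := ball_gt0_lty X_mms x r r0.
set M := fine (mu (ball x r)).
have muE : mu (ball x r) = M%:E by rewrite fineK// ge0_fin_numE// ltW.
have M0 : 0 < M by rewrite fine_gt0// B0.
have f_norm := besov_norm_bump_le X_mms D1 dbl p p_ge1 s x r s01 r01.
have K0 : 0 <= K.
  move: s01 => /andP[s0 s1]; have D0 : 0 <= D by exact: le_trans D1.
  rewrite addr_ge0// !mulr_ge0 ?exprn_ge0// addr_ge0//.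
    by rewrite invr_ge0 subr_ge0 ltW.
  by rewrite invr_ge0 ltW.
have f_besov : besov mu s p f.
  split; first exact: (bump_in_Lfun X_mms D1 dbl p p_ge1 x r r01).
  apply: le_lt_trans (ltry _).
  exact: (besov_seminorm_bump_le X_mms D1 dbl p p_ge1 s x r s01 r01).
have f_trace : is_trace mu nu E f f.
  apply: (lipschitz_is_trace X_mms nu E f r^-1 1) => // [y z|y].
    exact: bump_lipschitz.
  by rewrite ger0_norm ?bump_ge0 ?bump_le1.
have f_Lp : (Lp_norm_on nu E p f <= (C * K * (r `^ (- s) * M `^ p^-1))%:E)%E.
  apply: le_trans (HC f f_besov f f_trace) _.
  by rewrite -mulrA EFinM; apply: lee_wpmul2l; [rewrite lee_fin|exact: f_norm].
have mE : measurable (E : set (caratheodory_type nu)).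
  rewrite -[E]setCK; apply: measurableC.
  by apply: open_measurable_cara => //; exact: closed_openC.
have mB : measurable (ball x r : set (caratheodory_type nu)).
  by apply: open_measurable_cara => //; exact: metric_ball_open.
(* on ball x r the trace of f is the constant 1 *)
have nu_le : (nu (ball x r `&` E) <= \int[cara nu]_(y in E) (`|f y| `^ p)%:E)%E.
  have mBE := measurableI _ _ mB mE.
  rewrite -[leLHS]mul1e -(integral_cst (cara nu) mBE).
  rewrite [leLHS]integral_mkcond [leRHS]integral_mkcond.
  apply: le_nnintegral => y; rewrite !patchE; first by case: ifPn.
  case: ifPn => [/[!inE] -[By Ey]|_]; last first.
    by case: ifPn; rewrite ?lee_fin ?powR_ge0.
  by rewrite mem_set// /f bump_eq1// normr1 powR1.
have I0 : (0 <= \int[cara nu]_(y in E) (`|f y| `^ p)%:E)%E.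
  by apply: integral_ge0 => y _; rewrite lee_fin powR_ge0.
have : (\int[cara nu]_(y in E) (`|f y| `^ p)%:E <=
   ((C * K * (r `^ (- s) * M `^ p^-1)) `^ p)%:E)%E.
  rewrite -[leLHS]poweRe1// -(mulVf p_neq0) poweRrM -poweR_EFin.
  apply: gt0_ler_poweR f_Lp; rewrite ?(ltW p0)// in_itv/= leey andbT.
    exact: poweR_ge0.
  by rewrite lee_fin !mulr_ge0 ?powR_ge0.
move=> /(le_trans nu_le) /le_trans; apply.
rewrite muE inver gt_eqF ?powR_gt0// -!EFinM lee_fin.
rewrite (@powRM _ (C * K)) ?mulr_ge0 ?powR_ge0//.
rewrite (@powRM _ (r `^ _)) ?powR_ge0//.
rewrite -!powRrM mulVf// powRr1 ?(ltW M0)// mulNr divfK// powRN.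
rewrite [(_^-1 * M)%R]mulrC ler_wpM2r ?lerDl//.
by rewrite divr_ge0 ?powR_ge0// ltW.
Qed.
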